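(* Let $\mathbf{x}_*\ge\mathbf{0}$ be a solution of $\mathbf{x}=\mathbf{a}+\mathscr{B}\mathbf{x}^2$ with $R_{\mathbf{x}_*}$ nonsingular, let $\tilde{\mathbf{x}}_k$ be the iterate computed by Newton's method in machine arithmetic with precision $\mathsf{u}$, and let $\mathbf{e}_k$ be the error incurred when the residual $\mathbf{r}_k=\tilde{\mathbf{x}}_k-(\mathbf{a}+\mathscr{B}\tilde{\mathbf{x}}_k^2)$ is computed in machine arithmetic. When $\tilde{\mathbf{x}}_k-\mathbf{x}_*=o(1)$, we have (componentwise) $$|\mathbf{e}_k|\le\tilde\gamma_{n^2}\,\mathbf{x}_*+o(\mathsf{u}),$$ and hence $$\|R_{\mathbf{x}_*}^{-1}\mathbf{e}_k\|\le\tilde\gamma_{n^2}\,\big\|\,|R_{\mathbf{x}_*}^{-1}|\,\mathbf{x}_*\big\|+o(\mathsf{u}).$$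
   Context: $\mathbf{a}\in\mathbb{R}^n$ is a nonnegative vector and $\mathscr{B}=(b_{ijk})$ a nonnegative $n\times n\times n$ tensor; $(\mathscr{B}\mathbf{x}^2)_i=\sum_{j,k}b_{ijk}x_jx_k$. The matrix $R_{\mathbf{x}}$ has entries $(R_{\mathbf{x}})_{ij}=\delta_{ij}-\sum_k(b_{ikj}+b_{ijk})x_k$. $|\cdot|$ of a vector or matrix is the entrywise absolute value, inequalities between vectors are componentwise, and $\|\cdot\|$ is an absolute vector norm (e.g. the Euclidean norm). Machine arithmetic follows the standard model: each operation $\circ\in\{+,-,\times\}$ on floating-point numbers returns $(x\circ y)(1+\delta)$ with $|\delta|\le\mathsf{u}$. The residual is computed by first evaluating $\mathbf{p}_k=\mathbf{a}+\mathscr{B}\tilde{\mathbf{x}}_k^2$ in machine arithmetic (each component as a sum of $a_i$ and the $n^2$ terms $b_{ijl}(\tilde{x}_k)_j(\tilde{x}_k)_l$), obtaining $\tilde{\mathbf{p}}_k$, and then subtracting $\tilde{\mathbf{x}}_k-\tilde{\mathbf{p}}_k$ in machine arithmetic, obtaining $\tilde{\mathbf{r}}_k$; $\mathbf{e}_k=\tilde{\mathbf{r}}_k-\mathbf{r}_k$. $\tilde\gamma_m=\frac{Cm\mathsf{u}}{1-Cm\mathsf{u}}$ for a moderate absolute constant $C$ (its existence being part of the claim). The asymptotic notation refers to $\mathsf{u}\to0$ and $\tilde{\mathbf{x}}_k\to\mathbf{x}_*$ with $\mathbf{a},\mathscr{B},\mathbf{x}_*$ fixed: for every $\eta>0$ there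 is $\delta>0$ such that the $o(\mathsf{u})$ terms are bounded (in each component, resp. in absolute value) by $\eta\,\mathsf{u}$ whenever $\mathsf{u}<\delta$ and $\|\tilde{\mathbf{x}}_k-\mathbf{x}_*\|<\delta$. *)

(* Defs.v *)
From HB Require Import structures.
From mathcomp Require Import all_boot all_order all_algebra.
From mathcomp Require Import reals.

Set Implicit Arguments.
Unset Strict Implicit.
Unset Printing Implicit Defensive.

Import Order.TTheory GRing.Theory Num.Theory.
Local Open Scope ring_scope.

Section QuadraticVectorEquation.
Variables (R : realType) (n : nat).
Implicit Types (a x : 'cV[R]_n) (B : 'I_n -> 'I_n -> 'I_n -> R).

Definition tensor_quad B x : 'cV[R]_n :=
  \col_i \sum_j \sum_k B i j k * x j 0 * x k 0.

(* The Jacobian at x of y |-> y - (a + B y^2). *)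
Definition Rmat B x : 'M[R]_n :=
  \matrix_(i, j) ((i == j)%:R - \sum_k (B i k j + B i j k) * x k 0).

Definition residual a B x : 'cV[R]_n := x - (a + tensor_quad B x).

Record absolute_norm (N : 'cV[R]_n -> R) : Prop := AbsoluteNorm {
  absolute_norm_eq0 : forall x, N x = 0 -> x = 0;
  absolute_normZ : forall c x, N (c *: x) = `|c| * N x;
  absolute_normD : forall x y, N (x + y) <= N x + N y;
  absolute_norm_abs : forall x, N (map_mx Num.norm x) = N x
}.

End QuadraticVectorEquation.

Section MachineArithmetic.
Variables (R : realType) (u : R).

(* [fl v z]: z is an admissible machine result for an operation whose exact
   value is v, in the standard model with precision u. *)
Definition fl (v z : R) : Prop := exists2 d : R, `|d| <= u & z = v * (1 + d).

(* [computed op s v]: v is a machine value of the [op]-combination of the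
   nonempty list s.  The operands may be ordered and parenthesized in any way,
   and every application of [op] incurs its own rounding error. *)
Inductive computed (op : R -> R -> R) : seq R -> R -> Prop :=
| computed_one x : computed op [:: x] x
| computed_op s s1 s2 v1 v2 v :
    perm_eq s (s1 ++ s2) -> computed op s1 v1 -> computed op s2 v2 ->
    fl (op v1 v2) v -> computed op s v.

Variable n : nat.
Implicit Types (a x p r : 'cV[R]_n) (B : 'I_n -> 'I_n -> 'I_n -> R).

(* p is a machine value of a + B x^2; t j l is the computed B i j l * x_j * x_l. *)
Definition computed_map a B x p : Prop :=
  forall i, exists2 t : 'I_n -> 'I_n -> R,
    forall j l, computed *%R [:: B i j l; x j 0; x l 0] (t j l) &
    computed +%R (a i 0 :: [seq t j l | j <- enum 'I_n, l <- enum 'I_n]) (p i 0).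

Definition computed_residual a B x r : Prop :=
  exists2 p, computed_map a B x p & forall i, fl (x i 0 - p i 0) (r i 0).

(* The matrix E collects the errors made in forming the Jacobian at x and in
   solving the linear system for the Newton correction; it is left
   unrestricted, so that no particular linear solver is presupposed. *)
Definition newton_step B x r x' : Prop :=
  exists2 E : 'M[R]_n, Rmat B x + E \in unitmx &
    forall i, fl (x i 0 - (invmx (Rmat B x + E) *m r) i 0) (x' i 0).

(* x_0 is an arbitrary starting vector; r_k is the computed residual at x_k. *)
Definition newton_run a B (x r : nat -> 'cV[R]_n) : Prop :=
  forall k, computed_residual a B (x k) (r k) /\
            newton_step B (x k) (r k) (x k.+1).

Definition gamma_tilde (C : R) (m : nat) : R :=
  C * m%:R * u / (1 - C * m%:R * u).

End MachineArithmetic.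

(* Main.v *)
Require Import Defs.
From mathcomp Require Import all_boot all_order all_algebra.
From mathcomp Require Import reals.
From mathcomp Require Import ring lra.

(** The computed residual involves two stages with very different errors.
    Evaluating p = a + B x^2 costs at most two roundings per product and
    n^2 roundings on the way from any summand to the root of the summation
    tree, so its error is at most (1 + u)^(n^2 + 2) - 1 times
    P = a + B |x|^2, the value with all terms replaced by their absolute
    values (lemma computed_map_error).  The final subtraction costs one more
    rounding, relative to the small difference that it computes: it turns
    n^2 + 2 into n^2 + 3 and adds u |x - p| (lemma computed_residual_error).

    When x tends to the solution xs, both |x| and x tend to xs because
    xs >= 0, hence P tends to a + B xs^2 = xs and the residual x - p tends
    to 0.  So the first part of the error is gamma xs up to o(u), by the
    elementary bound (1 + u)^k <= 1 / (1 - k u), and the second is o(u).  The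
    constant C = 4 comes from n^2 + 3 <= 4 n^2 for n >= 1.  The local
    Lipschitz bound tensor_quad_lipschitz makes this quantitative.

    Two facts about an absolute norm finish the proof.  It is monotone in
    the entrywise absolute values (absolute_norm_le), which transfers the
    componentwise bound through the inverse of the Jacobian; and it controls
    each coordinate (absolute_norm_coord_le), so closeness in norm gives
    closeness of coordinates. *)

Set Implicit Arguments.
Unset Strict Implicit.
Unset Printing Implicit Defensive.

Import Order.TTheory GRing.Theory Num.Theory.
Local Open Scope ring_scope.

(** * Absolute norms *)

Section AbsoluteNorm.
Variables (R : realType) (n : nat) (N : 'cV[R]_n -> R).
Hypothesis absN : absolute_norm N.
Implicit Types x y z : 'cV[R]_n.

Lemma absolute_norm_ge0 x : 0 <= N x.
Proof.
have N0 : N 0 = 0 by rewrite -(scale0r x) (absolute_normZ absN) normr0 mul0r.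
have := absolute_normD absN x (- 1 *: x).
rewrite (absolute_normZ absN) normrN1 mul1r scaleN1r subrr N0; lra.
Qed.

(** If y' is y with the sign of its j-th entry flipped, then y' has the same
    norm as y, and shrinking the j-th entry of y gives a convex combination of
    y and y'. *)
Lemma absolute_norm_le1 j x y :
  (forall i, i != j -> x i 0 = y i 0) -> `|x j 0| <= `|y j 0| -> N x <= N y.
Proof.
move=> exy lexy.
pose y' : 'cV[R]_n := \col_i (if i == j then - y i 0 else y i 0).
have Ny' : N y' = N y.
  rewrite -(absolute_norm_abs absN y') -(absolute_norm_abs absN y).
  congr N; apply/matrixP=> i k; rewrite !mxE ord1.
  by case: eqP => // _; rewrite normrN.
have [t t1 xt] : exists2 t : R, `|t| <= 1 & x j 0 = t * y j 0.
  have [y0|y0] := eqVneq (y j 0) 0.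
    exists 0; first by rewrite normr0.
    by apply/eqP; rewrite mul0r -normr_le0 -(normr0 R) -y0.
  exists (x j 0 / y j 0); last by rewrite mulfVK.
  by rewrite normf_div ler_pdivrMr ?normr_gt0 // mul1r.
have -> : x = ((1 + t) / 2) *: y + ((1 - t) / 2) *: y'.
  apply/matrixP=> i k; rewrite !mxE ord1.
  have [->|ij] := eqVneq i j; first by rewrite xt; field.
  by rewrite exy //; field.
apply: le_trans (absolute_normD absN _ _) _.
rewrite !(absolute_normZ absN) Ny'.
move: t1; rewrite ler_norml => /andP[t1 t2].
rewrite !ger0_norm; [|lra|lra].
lra.
Qed.

(** Absolute norms are monotone: y is turned into x one entry at a time, and no
    such replacement increases the norm. *)
Lemma absolute_norm_le x y :
  (forall i, `|x i 0| <= `|y i 0|) -> N x <= N y.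
Proof.
move=> lexy.
pose z (s : seq 'I_n) : 'cV[R]_n := \col_i (if i \in s then x i 0 else y i 0).
have zs s : N (z s) <= N y.
  elim: s => [|j s IH].
    have -> : z [::] = y by apply/matrixP=> i k; rewrite !mxE ord1.
    exact: lexx.
  apply: le_trans IH; apply: (@absolute_norm_le1 j).
    by move=> i ij; rewrite !mxE inE (negPf ij).
  by rewrite !mxE mem_head; case: ifP.
suff -> : x = z (enum 'I_n) by [].
by apply/matrixP=> i k; rewrite !mxE mem_enum ord1.
Qed.

(** The half of the equivalence of norms that is needed to pass from closeness
    in norm to closeness of entries.  By monotonicity, |x_i| N(e_i) <= N(x) for
    the unit vector e_i. *)
Lemma absolute_norm_coord_le :
  exists2 c : R, 0 < c & forall x i, `|x i 0| <= c * N x.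
Proof.
have Nd i : 0 < N (delta_mx i 0).
  rewrite lt_neqAle absolute_norm_ge0 andbT eq_sym; apply/eqP.
  move=> /(absolute_norm_eq0 absN) /matrixP /(_ i 0) /eqP.
  by rewrite !mxE !eqxx oner_eq0.
have S0 (P : pred 'I_n) : 0 <= \sum_(i | P i) (N (delta_mx i 0))^-1.
  by apply: sumr_ge0 => i _; rewrite invr_ge0 ltW.
(* The summand 1 only serves to keep the constant positive when n = 0. *)
exists (1 + \sum_i (N (delta_mx i 0))^-1); first by have := S0 xpredT; lra.
move=> x i.
have : N (x i 0 *: delta_mx i 0) <= N x.
  apply: absolute_norm_le => k; rewrite !mxE eqxx andbT.
  by case: eqP => [->|_]; rewrite ?mulr1 ?mulr0 ?normr0.
rewrite (absolute_normZ absN) -ler_pdivlMr // => /le_trans; apply.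
rewrite mulrC ler_wpM2r ?absolute_norm_ge0 // (bigD1 i) //=.
by have := S0 (predC1 i) => /=; lra.
Qed.

Lemma absolute_norm_mulmx_le (A : 'M[R]_n) (e y : 'cV[R]_n) :
  (forall i, `|e i 0| <= y i 0) -> N (A *m e) <= N (map_mx Num.norm A *m y).
Proof.
move=> ley; apply: absolute_norm_le => i; rewrite !mxE.
apply: le_trans (ler_norm _); apply: le_trans (ler_norm_sum _ _ _) _.
by apply: ler_sum => j _; rewrite normrM mxE ler_wpM2l.
Qed.

End AbsoluteNorm.

(** * Accumulation of rounding errors *)

Section Rounding.
Variables (R : realType) (u : R).
Hypothesis u0 : 0 <= u.

(** One rounding multiplies the error factor q by 1 + u.  The error is measured
    against a bound A of |s| rather than |s| itself, because sums may cancel. *)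
Lemma fl_error q A w s v :
  `|s| <= A -> `|w - s| <= (q - 1) * A -> fl u w v ->
  `|v - s| <= (q * (1 + u) - 1) * A.
Proof.
move=> sA wsA [d du ->].
have -> : w * (1 + d) - s = (w - s) + d * ((w - s) + s) by ring.
have -> : (q * (1 + u) - 1) * A = (q - 1) * A + u * ((q - 1) * A + A) by ring.
apply: le_trans (ler_normD _ _) _; apply: lerD => //.
rewrite normrM ler_pM //; apply: le_trans (ler_normD _ _) _; exact: lerD.
Qed.

Lemma exprDu_ge1 k : 1 <= (1 + u) ^+ k.
Proof. by apply: exprn_ege1; rewrite lerDl. Qed.

Lemma exprDu_mono k l : (k <= l)%N -> (1 + u) ^+ k <= (1 + u) ^+ l.
Proof. by move=> kl; apply: ler_weXn2l; rewrite ?lerDl. Qed.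

Lemma computed_size op s v : computed u op s v -> (0 < size s)%N.
Proof.
elim=> // {}s s1 s2 v1 v2 {}v /perm_size -> _ s1_gt0 _ _ _.
by rewrite size_cat addn_gt0 s1_gt0.
Qed.

(** A binary tree with m leaves has m - 1 internal nodes, hence depth at most
    m - 1: this is the number of roundings that a summand can undergo. *)
Lemma computed_sum_error s v : computed u +%R s v ->
  `|v - \sum_(y <- s) y| <= ((1 + u) ^+ (size s).-1 - 1) * \sum_(y <- s) `|y|.
Proof.
elim=> [x|{}s s1 s2 v1 v2 {}v ps c1 IH1 c2 IH2 flv].
  by rewrite !big_seq1 subrr normr0 expr0 subrr mul0r.
rewrite (perm_size ps) !(perm_big _ ps) /= !big_cat size_cat /=.
move: (computed_size c1) (computed_size c2) => z1 z2.
case E1: (size s1) z1 IH1 => [//|k1] _ /= IH1.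
case E2: (size s2) z2 IH2 => [//|k2] _ /= IH2.
rewrite addnS exprSr; apply: fl_error flv.
  by apply: le_trans (ler_normD _ _) _; apply: lerD; exact: ler_norm_sum.
have -> (a b : R) : v1 + v2 - (a + b) = (v1 - a) + (v2 - b) by ring.
apply: le_trans (ler_normD _ _) _; rewrite mulrDr; apply: lerD.
  apply: le_trans IH1 _; rewrite ler_wpM2r ?sumr_ge0 // lerD2r.
  by rewrite exprDu_mono ?leq_addr.
apply: le_trans IH2 _; rewrite ler_wpM2r ?sumr_ge0 // lerD2r.
by rewrite exprDu_mono ?leq_addl.
Qed.

(** In a product, every internal node of the tree contributes one relative
    error to the final value, and there are exactly m - 1 of them. *)
Lemma computed_prod_error s v : computed u *%R s v ->
  `|v - \prod_(y <- s) y|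
    <= ((1 + u) ^+ (size s).-1 - 1) * `|\prod_(y <- s) y|.
Proof.
elim=> [x|{}s s1 s2 v1 v2 {}v ps c1 IH1 c2 IH2 flv].
  by rewrite !big_seq1 subrr normr0 expr0 subrr mul0r.
rewrite (perm_size ps) !(perm_big _ ps) /= !big_cat size_cat /=.
move: (computed_size c1) (computed_size c2) => z1 z2.
case E1: (size s1) z1 IH1 => [//|k1] _ /= IH1.
case E2: (size s2) z2 IH2 => [//|k2] _ /= IH2.
rewrite addnS exprSr exprD.
set q1 := (1 + u) ^+ k1 in IH1 *; set q2 := (1 + u) ^+ k2 in IH2 *.
move: (\prod_(y <- s1) y) (\prod_(y <- s2) y) IH1 IH2 => a b IH1 IH2.
apply: fl_error flv => //.
have -> : v1 * v2 - a * b = (v1 - a) * (v2 - b) + ((v1 - a) * b + a * (v2 - b)).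
  by ring.
have -> : (q1 * q2 - 1) * `|a * b| =
  (q1 - 1) * `|a| * ((q2 - 1) * `|b|)
    + ((q1 - 1) * `|a| * `|b| + `|a| * ((q2 - 1) * `|b|)).
  by rewrite normrM; ring.
apply: le_trans (ler_normD _ _) _; apply: lerD; first by rewrite normrM ler_pM.
apply: le_trans (ler_normD _ _) _.
by apply: lerD; rewrite normrM ?ler_wpM2r ?ler_wpM2l.
Qed.

(** Rests on (1 + u)^k (1 - k u) <= 1, which is preserved by k |-> k + 1 since
    (1 + u) (1 - (k + 1) u) <= 1 - k u. *)
Lemma exprDu_gamma_tilde (C : R) m k :
  0 <= C -> k%:R <= C * m%:R -> C * m%:R * u < 1 ->
  (1 + u) ^+ k - 1 <= gamma_tilde u C m.
Proof.
move=> C0 kC lt1; rewrite /gamma_tilde.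
have bern : (1 + u) ^+ k * (1 - k%:R * u) <= 1.
  elim: k {kC} => [|k IH]; first by rewrite expr0 mul0r subr0 mulr1.
  apply: le_trans IH; rewrite exprSr -mulrA ler_wpM2l
    ?(le_trans ler01 (exprDu_ge1 _)) //.
  rewrite -natr1; have : 0 <= k%:R * u ^+ 2 by rewrite mulr_ge0 ?sqr_ge0.
  by have := sqr_ge0 u; lra.
rewrite ler_pdivlMr; last by lra.
have : (1 + u) ^+ k * (1 - C * m%:R * u) <= (1 + u) ^+ k * (1 - k%:R * u).
  apply: ler_wpM2l; first by rewrite (le_trans ler01 (exprDu_ge1 _)).
  by have := ler_wpM2r u0 kC; lra.
lra.
Qed.

Lemma gamma_tilde_le (C : R) m : 0 <= C -> 2 * (C * m%:R * u) <= 1 ->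
  gamma_tilde u C m <= 2 * (C * m%:R) * u.
Proof.
move=> C0 le1; rewrite /gamma_tilde.
have m0 : 0 <= C * m%:R * u by rewrite !mulr_ge0.
rewrite ler_pdivrMr; last by lra.
have le1' : 0 <= 1 - 2 * (C * m%:R * u) by lra.
by have := mulr_ge0 m0 le1'; lra.
Qed.

Variable n : nat.
Implicit Types (a x p r : 'cV[R]_n) (B : 'I_n -> 'I_n -> 'I_n -> R).

(** The exponent counts the n^2 roundings of a sum of n^2 + 1 terms, plus the
    two roundings of a triple product. *)
Lemma computed_map_error a B x p i :
  (forall i, 0 <= a i 0) -> (forall i j k, 0 <= B i j k) ->
  computed_map u a B x p ->
  `|p i 0 - (a + tensor_quad B x) i 0|
    <= ((1 + u) ^+ (n ^ 2 + 2) - 1) * (a + tensor_quad B (map_mx Num.norm x)) i 0.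
Proof.
move=> a0 B0 /(_ i) [t t_prod /computed_sum_error].
rewrite /= size_allpairs size_enum_ord mulnn !big_cons !big_allpairs_dep !big_enum /=.
under eq_bigr do rewrite big_enum.
under [in X in _ <= _ * X -> _]eq_bigr do rewrite big_enum.
rewrite (ger0_norm (a0 i)) /= => err_sum.
rewrite !mxE.
have err_t j l : `|t j l - B i j l * x j 0 * x l 0| <=
    ((1 + u) ^+ 2 - 1) * (B i j l * `|x j 0| * `|x l 0|).
  have := computed_prod_error (t_prod j l).
  by rewrite !big_cons big_nil mulr1 mulrA !normrM (ger0_norm (B0 i j l)).
have bnd_t j l : `|t j l| <= (1 + u) ^+ 2 * (B i j l * `|x j 0| * `|x l 0|).
  rewrite -[t j l](subrK (B i j l * x j 0 * x l 0)).
  apply: le_trans (ler_normD _ _) _; have := err_t j l.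
  by rewrite !normrM (ger0_norm (B0 i j l)); lra.
set q := (1 + u) ^+ (n ^ 2) in err_sum.
have q1 : 1 <= q := exprDu_ge1 _.
have w1 := exprDu_ge1 2.
rewrite exprD -/q; set w := (1 + u) ^+ 2 in err_t bnd_t w1 *.
set T := \sum_j \sum_k B i j k * x j 0 * x k 0.
have -> : \sum_j \sum_k B i j k * map_mx Num.norm x j 0 * map_mx Num.norm x k 0 =
   \sum_j \sum_k B i j k * `|x j 0| * `|x k 0|.
  by apply: eq_bigr => j _; apply: eq_bigr => l _; rewrite !mxE.
set S := \sum_j \sum_k B i j k * `|x j 0| * `|x k 0|.
have dT : `|\sum_j \sum_k t j k - T| <= (w - 1) * S.
  rewrite -sumrB mulr_sumr; apply: le_trans (ler_norm_sum _ _ _) _.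
  apply: ler_sum => j _; rewrite -sumrB mulr_sumr.
  by apply: le_trans (ler_norm_sum _ _ _) _; apply: ler_sum => l _; exact: err_t.
have bT : \sum_j \sum_k `|t j k| <= w * S.
  rewrite mulr_sumr; apply: ler_sum => j _; rewrite mulr_sumr.
  by apply: ler_sum => l _; exact: bnd_t.
have S0 : 0 <= S.
  by apply: sumr_ge0 => j _; apply: sumr_ge0 => l _; rewrite !mulr_ge0.
have -> : p i 0 - (a i 0 + T) = (p i 0 - (a i 0 + \sum_j \sum_k t j k))
   + (\sum_j \sum_k t j k - T) by ring.
apply: le_trans (ler_normD _ _) _.
have h1 : (q - 1) * (a i 0 + \sum_j \sum_k `|t j k|) <= (q - 1) * (a i 0 + w * S).
  by rewrite ler_wpM2l ?subr_ge0 // lerD2l.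
have h2 : 0 <= q * (w - 1) * a i 0 by rewrite !mulr_ge0 //; lra.
lra.
Qed.

(** If p' is the computed value of p, the rounding d of the last subtraction
    gives (x - p') (1 + d) - (x - p) = (p - p') (1 + d) + d (x - p): only the
    exact residual x - p is charged with the extra u. *)
Lemma computed_residual_error a B x r i :
  (forall i, 0 <= a i 0) -> (forall i j k, 0 <= B i j k) ->
  computed_residual u a B x r ->
  `|(r - residual a B x) i 0|
    <= ((1 + u) ^+ (n ^ 2 + 3) - 1) * (a + tensor_quad B (map_mx Num.norm x)) i 0
       + u * `|residual a B x i 0|.
Proof.
move=> a0 B0 [p /(computed_map_error i a0 B0) err_p /(_ i) [d du r_eq]].
have -> : (r - residual a B x) i 0 =
   ((a + tensor_quad B x) i 0 - p i 0) * (1 + d) + d * residual a B x i 0.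
  by rewrite !mxE in r_eq *; rewrite r_eq; ring.
set P := (a + tensor_quad B (map_mx Num.norm x)) i 0 in err_p *.
have P0 : 0 <= P.
  rewrite /P !mxE addr_ge0 //; apply: sumr_ge0 => j _; apply: sumr_ge0 => l _.
  by rewrite !mxE !mulr_ge0.
apply: le_trans (ler_normD _ _) _; rewrite !normrM; apply: lerD; last first.
  by rewrite ler_wpM2r.
rewrite distrC addnS exprSr.
have d1 : `|1 + d| <= 1 + u.
  by apply: le_trans (ler_normD _ _) _; rewrite normr1 lerD2l.
apply: le_trans (ler_pM _ _ err_p d1) _ => //.
have : 0 <= u * P by rewrite mulr_ge0.
lra.
Qed.

End Rounding.

(** * Behaviour near the solution *)

(** The constant must not depend on y, which is why y is confined to the unit
    ball around xs: there the second order term of the expansion of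
    y_j y_k - xs_j xs_k is at most eps. *)
Lemma tensor_quad_lipschitz (R : realType) (n : nat)
    (B : 'I_n -> 'I_n -> 'I_n -> R) (xs : 'cV[R]_n) :
  (forall i j k, 0 <= B i j k) -> (forall i, 0 <= xs i 0) ->
  exists2 K : R, 0 <= K & forall (eps : R) (y : 'cV[R]_n), eps <= 1 ->
    (forall i, `|y i 0 - xs i 0| <= eps) ->
    forall i, `|tensor_quad B y i 0 - tensor_quad B xs i 0| <= K * eps.
Proof.
move=> B0 xs0.
pose M := \sum_i xs i 0.
have M0 : 0 <= M by apply: sumr_ge0.
have xsM i : xs i 0 <= M.
  by rewrite /M (bigD1 i) //= lerDl; apply: sumr_ge0.
pose b i := \sum_j \sum_k B i j k.
have b0 i : 0 <= b i by apply: sumr_ge0 => j _; apply: sumr_ge0.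
exists ((\sum_i b i) * (2 * M + 1)).
  by rewrite mulr_ge0 ?sumr_ge0 //; lra.
move=> eps y eps1 yx i.
have eps0 : 0 <= eps := le_trans (normr_ge0 _) (yx i).
rewrite !mxE -sumrB.
apply: (@le_trans _ _ (b i * ((2 * M + 1) * eps))); last first.
  rewrite mulrA !ler_wpM2r //; first by lra.
  by rewrite (bigD1 i) //= lerDl; apply: sumr_ge0.
rewrite mulr_suml; apply: le_trans (ler_norm_sum _ _ _) _.
apply: ler_sum => j _; rewrite -sumrB mulr_suml.
apply: le_trans (ler_norm_sum _ _ _) _; apply: ler_sum => k _.
rewrite -!mulrA -mulrBr normrM (ger0_norm (B0 i j k)) ler_wpM2l //.
have -> : y j 0 * y k 0 - xs j 0 * xs k 0 =
  (y j 0 - xs j 0) * (y k 0 - xs k 0)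
  + ((y j 0 - xs j 0) * xs k 0 + xs j 0 * (y k 0 - xs k 0)) by ring.
have e1 : `|(y j 0 - xs j 0) * (y k 0 - xs k 0)| <= eps * 1.
  by rewrite normrM ler_pM // (le_trans (yx k)).
have e2 : `|(y j 0 - xs j 0) * xs k 0| <= eps * M.
  by rewrite normrM ler_pM // ger0_norm.
have e3 : `|xs j 0 * (y k 0 - xs k 0)| <= M * eps.
  by rewrite normrM ler_pM // ger0_norm.
apply: le_trans (ler_normD _ _) _.
have := ler_normD ((y j 0 - xs j 0) * xs k 0) (xs j 0 * (y k 0 - xs k 0)).
lra.
Qed.

Theorem theorem6p2 (R : realType) :
  exists2 C : R, 0 < C &
  forall (n : nat) (a : 'cV[R]_n) (B : 'I_n -> 'I_n -> 'I_n -> R)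
         (xs : 'cV[R]_n) (N : 'cV[R]_n -> R),
    absolute_norm N ->
    (forall i, 0 <= a i 0) ->
    (forall i j k, 0 <= B i j k) ->
    (forall i, 0 <= xs i 0) ->
    xs = a + tensor_quad B xs ->
    Rmat B xs \in unitmx ->
    forall eta : R, 0 < eta ->
    exists2 delta : R, 0 < delta &
    forall u : R, 0 < u -> u < delta ->
    forall (x r : nat -> 'cV[R]_n) (k : nat),
      newton_run u a B x r ->
      N (x k - xs) < delta ->
      let e := r k - residual a B (x k) in
      (forall i, `|e i 0| <= gamma_tilde u C (n ^ 2) * xs i 0 + eta * u) /\
      N (invmx (Rmat B xs) *m e) <=
        gamma_tilde u C (n ^ 2)
          * N (map_mx Num.norm (invmx (Rmat B xs)) *m xs) + eta * u.
Proof.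
exists 4 => // n a B xs N absN a0 B0 xs0 xs_eq _ eta eta0.
have [c c0 coordN] := absolute_norm_coord_le absN.
have [K K0 lipB] := tensor_quad_lipschitz B0 xs0.
pose A := map_mx Num.norm (invmx (Rmat B xs)).
pose one : 'cV[R]_n := const_mx 1.
(* An error eta / D in each component has a norm of at most eta after
   multiplication by the inverse of the Jacobian. *)
pose D := 1 + N (A *m one).
have D0 : 0 < D by have := absolute_norm_ge0 absN (A *m one); rewrite /D; lra.
pose m : R := 4 * (n ^ 2)%:R.
have m0 : 0 <= m by rewrite mulr_ge0.
(* If x is within eps of xs, the o(u) part is at most L eps u: here
   gamma <= 2 m u multiplies P - xs <= K eps, and u multiplies the residual,
   which is at most (1 + K) eps. *)
pose L := 2 * m * K + (1 + K).
have L0 : 0 < L by have := mulr_ge0 m0 K0; rewrite /L; lra.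
pose eps := Num.min 1 (eta / D / L).
have eps0 : 0 < eps by rewrite lt_min ltr01 !divr_gt0.
have eps1 : eps <= 1 by rewrite ge_min lexx.
have epsL : L * eps <= eta / D.
  by rewrite mulrC -ler_pdivlMr // ge_min lexx orbT.
(* The second bound keeps 2 m u <= 1, away from the pole of gamma. *)
exists (Num.min (eps / c) (2 * m + 1)^-1).
  by rewrite lt_min divr_gt0 //= invr_gt0; lra.
move=> u u0; rewrite lt_min => /andP[_ um] x r k run.
rewrite lt_min => /andP[Nx _] e.
have {}u0 : 0 <= u := ltW u0.
have mu : 2 * (m * u) <= 1.
  have : u * (2 * m + 1) < 1 by rewrite -ltr_pdivlMr ?div1r //; lra.
  lra.
have muge0 : 0 <= m * u by rewrite mulr_ge0.
have xeps i : `|x k i 0 - xs i 0| <= eps.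
  have := coordN (x k - xs) i; rewrite !mxE => /le_trans; apply.
  by rewrite mulrC -ler_pdivlMr // ltW.
(* Taking absolute values does not move x away from xs, as xs >= 0. *)
have absxeps i : `|map_mx Num.norm (x k) i 0 - xs i 0| <= eps.
  rewrite mxE -{1}(ger0_norm (xs0 i)); apply: le_trans (xeps i).
  exact: ler_dist_dist.
have xsE i : xs i 0 = a i 0 + tensor_quad B xs i 0 by rewrite {1}xs_eq mxE.
have e_le i : `|e i 0| <= gamma_tilde u 4 (n ^ 2) * xs i 0 + eta / D * u.
  have [/(computed_residual_error u0 i a0 B0) err _] := run k.
  apply: le_trans err _.
  set P := (a + _) i 0.
  have P_le : P <= xs i 0 + K * eps.
    rewrite /P mxE (xsE i).
    by have := lipB _ _ eps1 absxeps i; rewrite ler_norml => /andP[]; lra.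
  have P0 : 0 <= P.
    rewrite /P !mxE addr_ge0 //; apply: sumr_ge0 => j _; apply: sumr_ge0 => l _.
    by rewrite !mxE !mulr_ge0.
  have res_le : `|residual a B (x k) i 0| <= (1 + K) * eps.
    have -> : residual a B (x k) i 0 = (x k i 0 - xs i 0)
       - (tensor_quad B (x k) i 0 - tensor_quad B xs i 0).
      by rewrite (xsE i) !mxE; ring.
    apply: le_trans (ler_normB _ _) _.
    by have := xeps i; have := lipB _ _ eps1 xeps i; lra.
  have n1 : (0 < n ^ 2)%N by rewrite expn_gt0 (leq_ltn_trans _ (ltn_ord i)).
  have pow_le : (1 + u) ^+ (n ^ 2 + 3) - 1 <= gamma_tilde u 4 (n ^ 2).
    apply: exprDu_gamma_tilde => //; last by rewrite -/m; lra.
    by rewrite -natrM ler_nat mulSn leq_add2l leq_pmulr.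
  have g_le : gamma_tilde u 4 (n ^ 2) <= 2 * m * u by apply: gamma_tilde_le.
  have g0 : 0 <= gamma_tilde u 4 (n ^ 2).
    by apply: le_trans pow_le; rewrite subr_ge0 exprDu_ge1.
  have h1 := ler_wpM2r P0 pow_le.
  have h2 := ler_wpM2l g0 P_le.
  have h3 := ler_wpM2r (mulr_ge0 K0 (ltW eps0)) g_le.
  have h4 := ler_wpM2l u0 res_le.
  have h5 := ler_wpM2r u0 epsL.
  rewrite /L in h5; lra.
have D1 : 1 <= D by have := absolute_norm_ge0 absN (A *m one); rewrite /D; lra.
split=> [i|].
  apply: le_trans (e_le i) _; rewrite lerD2l ler_wpM2r // ler_pdivrMr //.
  by rewrite ler_peMr // ltW.
pose y := gamma_tilde u 4 (n ^ 2) *: xs + (eta / D * u) *: one.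
have e_ley i : `|e i 0| <= y i 0.
  apply: le_trans (e_le i) _.
  by rewrite [y i 0]mxE [(_ *: xs) i 0]mxE [(_ *: one) i 0]mxE mxE mulr1.
apply: le_trans (absolute_norm_mulmx_le absN _ e_ley) _; rewrite -/A.
rewrite mulmxDr -!scalemxAr; apply: le_trans (absolute_normD absN _ _) _.
rewrite !(absolute_normZ absN) ger0_norm; last first.
  by rewrite divr_ge0 -/m //; lra.
rewrite lerD2l ger0_norm; last by rewrite mulr_ge0 // divr_ge0 // ltW.
have -> : eta / D * u * N (A *m one) = eta * u * (N (A *m one) / D) by ring.
rewrite ler_piMr ?mulr_ge0 ?(ltW eta0) // ler_pdivrMr // mul1r /D; lra.
Qed.
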